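(* Let $q$ be an odd prime power not in the set $\{$3, 5, 7, 9, 11, 13, 17, 19, 23, 25, 27, 29, 31, 37, 41, 43, 47, 49, 53, 59, 61, 67, 71, 73, 79, 81, 83, 89, 97, 101, 103, 109, 113, 121, 125, 127, 131, 137, 139, 149, 151, 157, 169, 173, 181, 191, 197, 199, 211, 229, 239, 241, 269, 281, 307, 311, 331, 337, 349, 361, 373, 379, 389, 409, 419, 421, 461, 463, 509, 521, 529, 569, 571, 601, 617, 631, 659, 661, 701, 761, 769, 841, 859, 881, 911, 1009, 1021, 1231, 1289, 1301, 1331, 1429, 1609, 1741, 1849, 1861, 2029, 2281, 2311, 2729, 3541$\}$. Then for every $\alpha \in \mathbb{F}_{q^2}^*$ and every $\theta \in \mathbb{F}_{q^2} \setminus \mathbb{F}_q$ there exists $x \in \mathbb{F}_q$ such that $\alpha(\theta+x)$ is $2$-primitive. In particular, for every odd prime power $q > 3541$, the extension $\mathbb{F}_{q^2}/\mathbb{F}_q$ possesses the line property for $2$-primitive elements.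
   Context: An element of $\mathbb{F}_{q^2}^*$ is $2$-primitive if its multiplicative order is $(q^2-1)/2$. The extension $\mathbb{F}_{q^2}/\mathbb{F}_q$ possesses the line property for $2$-primitive elements if for every $\alpha \in \mathbb{F}_{q^2}^*$ and every $\theta$ with $\mathbb{F}_{q^2}=\mathbb{F}_q(\theta)$, the set $\{\alpha(\theta+x): x\in\mathbb{F}_q\}$ contains a $2$-primitive element. *)

(* Defs.v *)
From HB Require Import structures.
From mathcomp Require Import all_boot all_order all_algebra all_field.
Set Implicit Arguments.
Unset Strict Implicit.
Unset Printing Implicit Defensive.
Import GRing.Theory.
Local Open Scope ring_scope.

Definition odd_prime_power (q : nat) : Prop :=
  odd q /\ exists p k : nat, [/\ prime p, (0 < k)%N & q = (p ^ k)%N].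

Definition exceptional_q : seq nat :=
  [:: 3; 5; 7; 9; 11; 13; 17; 19; 23; 25; 27; 29; 31; 37; 41; 43; 47; 49; 53;
      59; 61; 67; 71; 73; 79; 81; 83; 89; 97; 101; 103; 109; 113; 121; 125;
      127; 131; 137; 139; 149; 151; 157; 169; 173; 181; 191; 197; 199; 211;
      229; 239; 241; 269; 281; 307; 311; 331; 337; 349; 361; 373; 379; 389;
      409; 419; 421; 461; 463; 509; 521; 529; 569; 571; 601; 617; 631; 659;
      661; 701; 761; 769; 841; 859; 881; 911; 1009; 1021; 1231; 1289; 1301;
      1331; 1429; 1609; 1741; 1849; 1861; 2029; 2281; 2311; 2729; 3541]%N.

(* For L of degree 2 over F with q = #|F|.  [n.-primitive_root a] says that n  *)
(* is the least positive m with a ^+ m = 1, i.e. a has multiplicative order n; *)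
(* in particular a != 0.                                                       *)
Definition two_primitive (F : finFieldType) (L : fieldExtType F) (a : L) :
    bool :=
  ((#|F| ^ 2 - 1) %/ 2)%N.-primitive_root a.

(* Again for L of degree 2 over F; the base field F sits in L as 1%VS, via     *)
(* x |-> x%:A, and <<1; theta>>%VS is F(theta).                                *)
Definition line_property_two_primitive (F : finFieldType)
    (L : fieldExtType F) : Prop :=
  forall alpha theta : L, alpha != 0 -> <<1; theta>>%VS = {:L}%VS ->
    exists x : F, two_primitive (alpha * (theta + x%:A)).

(* Main.v *)
Require Import Defs.
From HB Require Import structures.
From Stdlib Require Import NArith.
From mathcomp Require Import all_boot all_order all_algebra all_solvable all_field.
From mathcomp Require Import ring zify.
Set Implicit Arguments.
Unset Strict Implicit.
Unset Printing Implicit Defensive.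
Import Order.TTheory GRing.Theory Num.Theory.
Local Open Scope ring_scope.

(* Write q = #|F| and n = q^2 - 1, let g generate the multiplicative group of *)
(* the quadratic extension and put chi_k (g^i) = w^(k i) for a primitive n-th *)
(* root of unity w. The sum of chi_k over the line alpha (theta + F) is q if  *)
(* n | k; it has modulus 1 if chi_k is nontrivial but trivial on F^*, since   *)
(* the line meets every coset of F^* but that of alpha exactly once; and it   *)
(* has modulus sqrt q otherwise, since (x, y) |-> (theta + x) / (theta + y)   *)
(* maps the pairs x != y bijectively to the elements outside F.               *)
(* An element g^i is 2-primitive iff i = 2 mod 4 and no odd prime divisor of  *)
(* n divides i. Expanding the condition for 2 and for a few core primes in    *)
(* characters, and removing the multiples of the other primes by a union      *)
(* bound, gives an explicit sufficient inequality. For q >= 122^2 it follows  *)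
(* from lower bounds on the i-th odd prime and on the product of the prime    *)
(* divisors of n. For smaller q it is checked by computation with at most one *)
(* core prime; the listed exceptions are the prime powers that do not pass.   *)

(** * Multiplicative characters on a line *)

(** A 2-primitive element is g^i with gcd(i, n) = 2 ([prim_root_half]), so the task is to find a
    point of the line with suitable discrete logarithm. The line sums [line_sum_class] and
    [line_sum_norm] are the only input from field arithmetic; the sieve itself works with a finite
    set X and a map l from X to exponents.

    A nonnegative weight h detects i = 2 mod 4 and the core primes, and [char_bounded] records its
    error: u for the characters trivial on F^*, v sqrt q for the others. A core prime dividing q + 1
    changes (u, v) into (2u, 2v), one dividing q - 1 into (u, 2v + u). If every point in the support
    of h had a logarithm divisible by some remaining prime of s, then adding up the estimates of
    [sift_multiples] would give [sift_inequality]. Hence a point exists ([sieve_logarithms]) as soon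
    as sum (1 - 1/p) cost(p) < delta (q - (u - 1 + v sqrt q)), with delta = 1 - sum 1/p, both sums
    over s.

    Below 122^2 this is evaluated exactly in integers ([sieve_checkN]). Above, [large_sieve] plays
    the number of odd primes dividing n against q: their product is at most q^2 / 8, so many primes
    force a large q. *)

Lemma finField_prim_root (K : finFieldType) :
  exists g : K, #|K|.-1.-primitive_root g.
Proof.
have K_gt1 := finNzRing_gt1 K.
have /hasP[g _ prim_g] : has #|K|.-1.-primitive_root [seq x <- enum K | x != 0].
  apply: has_prim_root.
  - by rewrite -ltnS (ltn_predK K_gt1).
  - apply/allP=> x; rewrite mem_filter unity_rootE => /andP[nz_x _].
    by rewrite -(inj_eq (mulfI nz_x)) -exprS (ltn_predK K_gt1) expf_card mulr1.
  - exact/filter_uniq/enum_uniq.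
  rewrite -(cardC1 (0 : K)) cardE; apply: eq_leq; congr (size _).
  by rewrite enumT; apply: eq_filter => x; rewrite !inE.
by exists g.
Qed.

Section MultiplicativeCharacters.

Variables (K : finFieldType) (g : K) (w : algC).
Local Notation n := #|K|.-1.
Hypotheses (prim_g : n.-primitive_root g) (prim_w : n.-primitive_root w).

Definition dlog (a : K) : nat := index a [seq g ^+ i | i <- iota 0 n].

Lemma dlogK (a : K) : a != 0 -> g ^+ dlog a = a.
Proof.
move=> nz_a; have n_gt0 := prim_order_gt0 prim_g.
have an1 : a ^+ n = 1.
  apply: (mulfI nz_a).
  by rewrite -exprS (ltn_predK (finNzRing_gt1 K)) expf_card mulr1.
have [i def_a] := prim_rootP prim_g an1.
have a_in : a \in [seq g ^+ i | i <- iota 0 n].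
  by rewrite def_a map_f // mem_iota /= add0n.
move: (a_in); rewrite -index_mem size_map size_iota => lt_in.
by rewrite -[RHS](nth_index 0 a_in) (nth_map 0) ?size_iota // nth_iota.
Qed.

(** The value at 0 is set apart, since [dlog 0] is only the default index n. *)
Definition mchar (k : nat) (a : K) : algC :=
  if a == 0 then 0 else w ^+ (k * dlog a).

Lemma mcharE (k : nat) (a : K) : a != 0 -> mchar k a = w ^+ (k * dlog a).
Proof. by rewrite /mchar => /negPf->. Qed.

Lemma mcharX (k i : nat) : mchar k (g ^+ i) = w ^+ (k * i).
Proof.
have nz_gi : g ^+ i != 0.
  by rewrite expf_neq0 // (prim_root_eq0 prim_g) -lt0n (prim_order_gt0 prim_g).
rewrite mcharE //; apply/eqP; rewrite (eq_prim_root_expr prim_w).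
have /eqP := dlogK nz_gi; rewrite (eq_prim_root_expr prim_g) => /eqP e.
by rewrite -modnMmr e modnMmr.
Qed.

Lemma mcharM (k : nat) : {morph mchar k : a b / a * b}.
Proof.
move=> a b; have [->|nz_a] := eqVneq a 0; first by rewrite /mchar !mul0r eqxx mul0r.
have [->|nz_b] := eqVneq b 0; first by rewrite /mchar !mulr0 eqxx mulr0.
by rewrite -{1}(dlogK nz_a) -{1}(dlogK nz_b) -exprD mcharX mulnDr exprD !mcharE.
Qed.

Lemma mchar0 (k : nat) : mchar k 0 = 0.
Proof. by rewrite /mchar eqxx. Qed.

Lemma mchar1 (k : nat) : mchar k 1 = 1.
Proof. by rewrite -(expr0 g) mcharX muln0. Qed.

Lemma norm_mchar (k : nat) (a : K) : a != 0 -> `|mchar k a| = 1.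
Proof.
move=> nz_a; rewrite mcharE // normrX.
have /eqP := congr1 Num.norm (prim_expr_order prim_w).
rewrite normrX normr1 pexpr_eq1 ?(prim_order_gt0 prim_w) // => /eqP->.
by rewrite expr1n.
Qed.

Lemma mchar_conj (k : nat) (a : K) : a != 0 -> (mchar k a)^* = mchar k a^-1.
Proof.
move=> nz_a; have nz_c : mchar k a != 0 by rewrite -normr_eq0 norm_mchar ?oner_eq0.
apply: (mulfI nz_c); rewrite -normCK norm_mchar // -mcharM mulfV // mchar1.
by rewrite expr1n.
Qed.

Lemma sum_mchar (k : nat) : ~~ (n %| k)%N -> \sum_a mchar k a = 0.
Proof.
move=> ndv_k.
have nz_g : g != 0 by rewrite (prim_root_eq0 prim_g) -lt0n (prim_order_gt0 prim_g).
have wk1 : mchar k g != 1.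
  by rewrite -[g]expr1 mcharX muln1 -(prim_order_dvd prim_w).
have e : mchar k g * (\sum_a mchar k a) = \sum_a mchar k a.
  rewrite mulr_sumr [RHS](reindex_inj (mulfI nz_g)).
  by apply: eq_bigr => a _; rewrite mcharM.
apply/eqP; move/eqP: e; rewrite -subr_eq0 -{2}[\sum_a _]mul1r -mulrBl mulf_eq0.
by rewrite subr_eq0 (negPf wk1).
Qed.

End MultiplicativeCharacters.

(** * Character sums over the line alpha (theta + F) *)

Section LineSums.

Variables (F K : finFieldType) (iota : {rmorphism F -> K}).
Local Notation q := #|F|.
Local Notation n := #|K|.-1.
Hypothesis cardK : #|K| = (q ^ 2)%N.
Variables (g : K) (w : algC).
Hypotheses (prim_g : n.-primitive_root g) (prim_w : n.-primitive_root w).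
Local Notation chi := (mchar g w).
Variables (alpha theta : K).
Hypotheses (nz_alpha : alpha != 0) (thetaNF : forall x, theta != iota x).

Let q_gt1 : (1 < q)%N. Proof. exact: finNzRing_gt1. Qed.

Lemma iota_card_pred (c : F) : c != 0 -> iota c ^+ q.-1 = 1.
Proof.
move=> nz_c; rewrite -rmorphXn -(rmorph1 iota); congr (iota _).
by apply: (mulfI nz_c); rewrite -exprS (ltn_predK q_gt1) expf_card mulr1.
Qed.

Lemma mchar_base (k : nat) (c : F) : (q.-1 %| k)%N -> c != 0 -> chi k (iota c) = 1.
Proof.
case/dvdnP=> k' -> nz_c; have nz_ic : iota c != 0 by rewrite fmorph_eq0.
rewrite mcharE //; apply/eqP; rewrite -(prim_order_dvd prim_w) -mulnA dvdn_mull //.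
rewrite mulnC (prim_order_dvd prim_g) exprM (dlogK prim_g) //.
by rewrite iota_card_pred.
Qed.

Lemma sum_mchar_base (k : nat) : ~~ (q.-1 %| k)%N -> \sum_c chi k (iota c) = 0.
Proof.
move=> ndv_k; have [gF prim_gF] := finField_prim_root F.
have nz_gF : gF != 0 by rewrite (prim_root_eq0 prim_gF) -lt0n (prim_order_gt0 prim_gF).
have nz_ig : iota gF != 0 by rewrite fmorph_eq0.
have chi_gF : chi k (iota gF) != 1.
  rewrite mcharE // -(prim_order_dvd prim_w) mulnC (prim_order_dvd prim_g) exprM.
  rewrite (dlogK prim_g) // -rmorphXn -(rmorph1 iota) (inj_eq (fmorph_inj _)).
  by rewrite -(prim_order_dvd prim_gF).
have e : chi k (iota gF) * (\sum_c chi k (iota c)) = \sum_c chi k (iota c).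
  rewrite mulr_sumr [RHS](reindex_inj (mulfI nz_gF)).
  by apply: eq_bigr => a _; rewrite rmorphM (mcharM prim_g prim_w).
apply/eqP; move/eqP: e; rewrite -subr_eq0 -{2}[\sum_c _]mul1r -mulrBl mulf_eq0.
by rewrite subr_eq0 (negPf chi_gF).
Qed.

Definition pair_elt (cd : F * F) : K := iota cd.1 + iota cd.2 * theta.

Lemma pair_elt_inj : injective pair_elt.
Proof.
move=> [c d] [c' d']; rewrite /pair_elt /= => e.
have e2 : iota (c - c') = iota (d' - d) * theta.
  rewrite !rmorphB mulrBl; apply/eqP; rewrite subr_eq addrAC eq_sym subr_eq.
  by rewrite [X in _ == X]e [iota c' + _]addrC.
have [eq_d|neq_d] := eqVneq d d'.
  move: e2; rewrite eq_d subrr rmorph0 mul0r => /eqP; rewrite fmorph_eq0 subr_eq0.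
  by move/eqP->.
case/eqP: (thetaNF ((c - c') / (d' - d))).
have nz : iota (d' - d) != 0 by rewrite fmorph_eq0 subr_eq0 eq_sym.
by apply: (mulfI nz); rewrite -e2 -rmorphM mulrCA mulfV ?mulr1 // subr_eq0 eq_sym.
Qed.

Lemma pair_elt_bij : bijective pair_elt.
Proof.
apply: inj_card_bij; first exact: pair_elt_inj.
by rewrite cardK card_prod mulnn.
Qed.

Lemma theta_add_neq0 (x : F) : theta + iota x != 0.
Proof. by rewrite addr_eq0 -rmorphN thetaNF. Qed.

(** Split the vanishing sum over K by the theta-coordinate d. The slice d = 0 gives (q - 1)
    chi(alpha), and each d != 0 gives a copy of the line sum, since chi is trivial on F^*. *)
Lemma line_sum_class (k : nat) : (q.-1 %| k)%N -> ~~ (n %| k)%N ->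
  \sum_x chi k (alpha * (theta + iota x)) = - chi k alpha.
Proof.
move=> dv_k ndv_k; have := sum_mchar prim_g prim_w ndv_k.
rewrite (reindex_inj (mulfI nz_alpha)) (reindex _ (onW_bij _ pair_elt_bij)).
rewrite /pair_elt -(pair_bigA _ (fun c d => chi k (alpha * (iota c + iota d * theta)))).
rewrite exchange_big (bigD1 0) //=.
under eq_bigr => c _ do rewrite rmorph0 mul0r addr0 (mcharM prim_g prim_w).
rewrite -mulr_sumr (bigD1 0) //= rmorph0 mchar0 add0r.
rewrite (eq_bigr (fun => 1)); last by move=> c nz_c; exact: mchar_base.
set S := \sum_x chi k _.
rewrite [X in _ + X](eq_bigr (fun => S)) => [|d nz_d]; last first.
  rewrite (reindex_inj (mulfI nz_d)); apply: eq_bigr => x _.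
  rewrite rmorphM -mulrDr [iota x + _]addrC mulrCA [LHS](mcharM prim_g prim_w).
  by rewrite mchar_base // mul1r.
rewrite !sumr_const mulr_natr -mulrnDl => /eqP; rewrite mulrn_eq0.
rewrite cardC1 -leqn0 leqNgt -ltnS (ltn_predK q_gt1) q_gt1 /= addrC addr_eq0.
by move/eqP.
Qed.

(** Expand the square. The diagonal gives q; the remaining quotients run once through K minus F,
    where chi sums to 0 because its sums over K and over F both vanish. *)
Lemma line_sum_norm (k : nat) : ~~ (q.-1 %| k)%N ->
  `|\sum_x chi k (alpha * (theta + iota x))| ^+ 2 = q%:R.
Proof.
move=> ndv_k.
have dv_qn : (q.-1 %| n)%N.
  have := subn_sqr q 1; rewrite exp1n !subn1 -cardK => ->.
  exact: dvdn_mulr.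
have ndv_nk : ~~ (n %| k)%N by apply: contra ndv_k; apply: dvdn_trans.
under eq_bigr => x _ do rewrite (mcharM prim_g prim_w).
rewrite -mulr_sumr normrM (norm_mchar _ prim_w) // mul1r normCK rmorph_sum /=.
rewrite big_distrlr /=; pose f x y := chi k ((theta + iota x) / (theta + iota y)).
have fE x y : chi k (theta + iota x) * (chi k (theta + iota y))^* = f x y.
  by rewrite (mchar_conj prim_g prim_w) ?theta_add_neq0 // -(mcharM prim_g prim_w).
under eq_bigr => x _ do under eq_bigr => y _ do rewrite fE.
pose P (xy : F * F) := xy.1 != xy.2; pose diag := [set (x, x) | x : F].
have diag_inj : injective (fun x : F => (x, x)) by move=> x y [].
have PE xy : P xy = (xy \notin diag).
  case: xy => x y; congr (~~ _).
  by apply/eqP/imsetP => /= [->|[z _ [-> ->]]] //; exists y.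
rewrite pair_bigA /= (bigID P) /= addrC.
have -> : \sum_(xy | ~~ P xy) f xy.1 xy.2 = q%:R.
  rewrite (eq_bigl (mem diag)) => [|xy]; last by rewrite PE negbK.
  rewrite big_imset; last by move=> x y _ _; exact: diag_inj.
  rewrite (eq_bigr (fun => 1)) => [|x _]; first by rewrite sumr_const.
  by rewrite /f divff ?theta_add_neq0 // (mchar1 prim_g prim_w).
rewrite -[RHS]addr0; congr (_ + _).
pose m (xy : F * F) := (theta + iota xy.1) / (theta + iota xy.2).
(* Cross-multiplying equal quotients and comparing coordinates gives x y' = x' y and x + y' = x' +
   y, which determine the pair because x != y. *)
have m_inj : {in ~: diag &, injective m}.
  move=> [x y] [x' y']; rewrite !in_setC -!PE /P /m /= => neq_xy _ /eqP.
  rewrite eqr_div ?theta_add_neq0 // => /eqP e.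
  have : pair_elt (x * y', x + y') = pair_elt (x' * y, x' + y).
    apply: (addrI (theta * theta)); rewrite /pair_elt /= !rmorphD !rmorphM.
    transitivity ((theta + iota x) * (theta + iota y')); first ring.
    by rewrite e; ring.
  move/pair_elt_inj=> [e1 e2].
  have eq_d : x - y = x' - y'.
    by apply/eqP; rewrite subr_eq addrAC eq_sym subr_eq e2.
  have eq_y : y = y'.
    have nz_d : x - y != 0 by rewrite subr_eq0.
    by apply: (mulfI nz_d); rewrite {1}eq_d !mulrBl -e1 [y' * y]mulrC.
  by rewrite -eq_y in eq_d *; rewrite (addIr _ eq_d).
(* One inclusion suffices, as both sides have q^2 - q elements. *)
have im_m : m @: (~: diag) = ~: [set iota x | x : F].
  apply/eqP; rewrite eqEcard; apply/andP; split.
    apply/subsetP=> a /imsetP[[x y]]; rewrite !in_setC -PE /P /= => neq_xy ->{a}.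
    apply/imsetP=> -[c _ /(canRL (divfK (theta_add_neq0 y)))/= e].
    have : pair_elt (x, 1) = pair_elt (c * y, c).
      by rewrite /pair_elt /= rmorph1 mul1r addrC e rmorphM mulrDr addrC.
    by move/pair_elt_inj=> [ex ec]; case/eqP: neq_xy; rewrite ex -ec mul1r.
  rewrite (card_in_imset m_inj).
  rewrite (cardsCs (~: diag)) (cardsCs (~: [set iota x | x : F])) !setCK.
  rewrite cardK card_prod mulnn.
  by rewrite (card_imset _ diag_inj) (card_imset _ (fmorph_inj iota)).
rewrite (eq_bigl (mem (~: diag))) => [|xy]; last by rewrite PE -in_setC.
rewrite -(big_imset (chi k)) /=; last exact: m_inj.
rewrite im_m; have := sum_mchar prim_g prim_w ndv_nk.
rewrite (bigID (mem [set iota x | x : F])) /= big_imset /=; last first.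
  by move=> x y _ _; exact: fmorph_inj.
rewrite sum_mchar_base // add0r; apply: etrans.
by apply: eq_bigl => a; rewrite in_setC.
Qed.

End LineSums.

(** * The character sieve *)

Lemma sum_unity_roots (n l i : nat) (w : algC) :
  n.-primitive_root w -> (l %| n)%N ->
  \sum_(0 <= j < l) w ^+ (j * (n %/ l) * i) = if (l %| i)%N then l%:R else 0.
Proof.
move=> prim_w dv_l; have prim_l := dvdn_prim_root prim_w dv_l.
set z := w ^+ _ in prim_l.
under eq_bigr => j _ do rewrite -mulnAC mulnC exprM -/z mulnC exprM.
have [dv_i|ndv_i] := ifPn.
  have /eqP-> : z ^+ i == 1 by rewrite -(prim_order_dvd prim_l).
  by under eq_bigr => j _ do rewrite expr1n; rewrite sumr_const_nat subn0.
have z1 : z ^+ i - 1 != 0 by rewrite subr_eq0 -(prim_order_dvd prim_l).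
apply: (mulfI z1); rewrite big_mkord -subrX1 mulr0 -exprM mulnC exprM.
by rewrite (prim_expr_order prim_l) expr1n subrr.
Qed.

Section CharacterSieve.

Variables (X : finType) (l : X -> nat) (q : nat) (w r : algC).
Local Notation n := (q.-1 * q.+1)%N.
Hypotheses (q_gt1 : (1 < q)%N) (odd_q : odd q) (prim_w : n.-primitive_root w).

Definition twist (h : X -> algC) (k : nat) : algC :=
  \sum_x h x * w ^+ (k * l x).

(* The weight h stands for a combination of characters whose orders divide M, *)
(* in which the trivial character has coefficient 1; the absolute             *)
(* coefficients of the characters trivial on F^* add up to u, the others to   *)
(* v.                                                                         *)
Definition char_bounded (M u v : nat) (h : X -> algC) : Prop :=
  [/\ forall k, ~~ (q.-1 %| k * M)%N -> `|twist h k| <= (u + v)%:R * r,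
      forall k, (q.-1 %| k)%N -> ~~ (n %| k * M)%N ->
        `|twist h k| <= u%:R + v%:R * r
    & `|twist h 0 - q%:R| <= (u%:R - 1) + v%:R * r].

(* Normalised to have mean value 1 over the residues i modulo p. *)
Definition free_weight (p i : nat) : algC :=
  if (p %| i)%N then 0 else p%:R / (p%:R - 1).

Lemma free_weight_ge0 (p i : nat) : (0 < p)%N -> 0 <= free_weight p i.
Proof.
move=> p_gt0; rewrite /free_weight; case: ifP => // _.
by rewrite divr_ge0 ?ler0n // subr_ge0 ler1n.
Qed.

(** The p - 1 characters of order p share the coefficient -1/(p - 1), so their absolute coefficients
    add up to 1; this is why a core prime just doubles u + v. *)
Lemma free_weightE (p i : nat) : (1 < p)%N -> (p %| n)%N ->
  free_weight p i = 1 - (p%:R - 1)^-1 * \sum_(1 <= j < p) w ^+ (j * (n %/ p) * i).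
Proof.
move=> p_gt1 dv_p; have := sum_unity_roots i prim_w dv_p.
rewrite big_ltn ?(ltnW p_gt1) // !mul0n expr0 => /(canRL (addKr _))->.
have nz_p : p%:R - 1 != 0 :> algC by rewrite subr_eq0 (eqr_nat _ p 1) neq_ltn p_gt1 orbT.
by rewrite /free_weight; case: ifP => _; field.
Qed.

Lemma twist_free (h : X -> algC) (p k : nat) (B : algC) :
    (1 < p)%N -> (p %| n)%N ->
    (forall j, (0 < j < p)%N -> `|twist h (k + j * (n %/ p))| <= B) ->
  `|twist (fun x => h x * free_weight p (l x)) k - twist h k| <= B.
Proof.
move=> p_gt1 dv_p bB.
have p1_gt0 : 0 < p%:R - 1 :> algC by rewrite subr_gt0 ltr1n.
have -> : twist (fun x => h x * free_weight p (l x)) k - twist h k =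
    - (p%:R - 1)^-1 * \sum_(1 <= j < p) twist h (k + j * (n %/ p)).
  rewrite /twist -sumrB exchange_big mulr_sumr; apply: eq_bigr => x _.
  under [in RHS]eq_bigr => j _ do rewrite mulnDl exprD mulrA.
  by rewrite -mulr_sumr free_weightE //; ring.
rewrite normrM normrN normfV (gtr0_norm p1_gt0) mulrC ler_pdivrMr //.
apply: le_trans (ler_norm_sum _ _ _) _.
rewrite -(natrB _ (ltnW p_gt1)) mulr_natr -sumr_const_nat.
by rewrite !big_nat; apply: ler_sum => j; apply: bB.
Qed.

Section Step.

Variables (h : X -> algC) (M u v p : nat).
Hypotheses (bh : char_bounded M u v h) (p_gt1 : (1 < p)%N) (odd_p : odd p).
Hypothesis copM : coprime p M.
Local Notation h' := (fun x => h x * free_weight p (l x)).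

(** Multiplied by p, the shift j n / p becomes a multiple of n, hence of d. *)
Let generic_shift (k j d : nat) : (p %| n)%N -> (d %| n)%N ->
  ~~ (d %| k * (M * p))%N -> ~~ (d %| (k + j * (n %/ p)) * M)%N.
Proof.
move=> dv_p dv_d; apply: contra => /(dvdn_mulr p).
rewrite mulnDl mulnDl -mulnA dvdn_addl //.
by rewrite mulnAC -[(j * _ * p)%N]mulnA divnK // mulnAC dvdn_mull.
Qed.

Lemma class_shift (j : nat) : (p %| q.+1)%N -> (0 < j < p)%N ->
  ~~ (n %| j * (n %/ p) * M)%N.
Proof.
move=> dv_p /andP[j_gt0 j_lt]; have dv_pn : (p %| n)%N by apply: dvdn_mull.
have N_gt0 : (0 < n %/ p)%N.
  rewrite divn_gt0 ?(ltnW p_gt1) // dvdn_leq // muln_gt0.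
  by rewrite -ltnS (ltn_predK q_gt1) q_gt1.
rewrite -mulnA mulnCA -[X in (X %| _)%N](divnK dv_pn) dvdn_pmul2l //.
by rewrite Gauss_dvdl // gtnNdvd.
Qed.

(** Being odd, p is prime to q + 1. Since n / p = ((q - 1) / p) (q + 1), divisibility by q - 1 would
    force p to divide j. *)
Lemma base_shift (k j : nat) : (p %| q.-1)%N -> (q.-1 %| k)%N -> (0 < j < p)%N ->
  ~~ (q.-1 %| (k + j * (n %/ p)) * M)%N.
Proof.
move=> dv_p dv_k /andP[j_gt0 j_lt].
have cop_q : coprime p q.+1.
  rewrite -(ltn_predK q_gt1) -addn2 /coprime -gcdn_modr.
  by rewrite -modnDml (eqP dv_p) add0n gcdn_modr -/(coprime p 2) coprimen2.
move: dv_p; case/dvdnP=> a def_q; have a_gt0 : (0 < a)%N.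
  by move: q_gt1; rewrite -ltn_predRL def_q; case: (a).
rewrite mulnDl dvdn_addr; last exact: dvdn_mulr.
have -> : (n %/ p = a * q.+1)%N by rewrite def_q mulnAC mulnK ?(ltnW p_gt1).
rewrite [X in (X %| _)%N]def_q mulnCA -mulnA dvdn_pmul2l //.
by rewrite mulnC mulnA Gauss_dvdl // mulnC Gauss_dvdl // gtnNdvd.
Qed.

(** Characters of order p are here trivial on F^*, so the shifted twists obey the same kind of bound
    as the original one. *)
Lemma char_bounded_freeS : (p %| q.+1)%N -> char_bounded (M * p) (2 * u) (2 * v) h'.
Proof.
move=> dv_p; have [b1 b2 b3] := bh.
have dv_pn : (p %| n)%N by apply: dvdn_mull.
have dv_N j : (q.-1 %| j * (n %/ p))%N.
  by apply: dvdn_mull; rewrite -muln_divA //; apply: dvdn_mulr.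
split=> [k ndv_k|k dv_k ndv_k|].
- have := @twist_free h p k ((u + v)%:R * r) p_gt1 dv_pn.
  move=> /(_ (fun j _ => b1 _ (generic_shift j dv_pn (dvdn_mulr _ (dvdnn _)) ndv_k))).
  have /b1 : ~~ (q.-1 %| k * M)%N by apply: contra ndv_k; rewrite mulnA; apply: dvdn_mulr.
  move=> b b'; rewrite -[twist h' k](subrK (twist h k)).
  apply: le_trans (ler_normD _ _) (le_trans (lerD b' b) _).
  by rewrite le_eqVlt; apply/orP; left; apply/eqP; ring.
- have bk j : (0 < j < p)%N -> `|twist h (k + j * (n %/ p))| <= u%:R + v%:R * r.
    by move=> _; apply: b2; [rewrite dvdn_add | apply: generic_shift].
  have /(b2 k dv_k) b : ~~ (n %| k * M)%N.
    by apply: contra ndv_k; rewrite mulnA; apply: dvdn_mulr.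
  have b' := twist_free p_gt1 dv_pn bk; rewrite -[twist h' k](subrK (twist h k)).
  apply: le_trans (ler_normD _ _) (le_trans (lerD b' b) _).
  by rewrite le_eqVlt; apply/orP; left; apply/eqP; ring.
have bk j : (0 < j < p)%N -> `|twist h (0 + j * (n %/ p))| <= u%:R + v%:R * r.
  by move=> lt_j; apply: b2; [rewrite add0n | rewrite add0n class_shift].
have b' := twist_free p_gt1 dv_pn bk.
have -> : twist h' 0 - q%:R = (twist h' 0 - twist h 0) + (twist h 0 - q%:R) by ring.
apply: le_trans (ler_normD _ _) (le_trans (lerD b' b3) _).
by rewrite le_eqVlt; apply/orP; left; apply/eqP; ring.
Qed.

(** Characters of order p are here nontrivial on F^*, so every shifted twist is generic and the
    correction costs (u + v) r; u itself does not grow. *)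
Lemma char_bounded_freeP : (p %| q.-1)%N -> char_bounded (M * p) u (2 * v + u) h'.
Proof.
move=> dv_p; have [b1 b2 b3] := bh.
have dv_pn : (p %| n)%N by apply: dvdn_mulr.
split=> [k ndv_k|k dv_k ndv_k|].
- have := @twist_free h p k ((u + v)%:R * r) p_gt1 dv_pn.
  move=> /(_ (fun j _ => b1 _ (generic_shift j dv_pn (dvdn_mulr _ (dvdnn _)) ndv_k))).
  have /b1 : ~~ (q.-1 %| k * M)%N by apply: contra ndv_k; rewrite mulnA; apply: dvdn_mulr.
  move=> b b'; rewrite -[twist h' k](subrK (twist h k)).
  apply: le_trans (ler_normD _ _) (le_trans (lerD b' b) _).
  by rewrite le_eqVlt; apply/orP; left; apply/eqP; ring.
- have bk j : (0 < j < p)%N -> `|twist h (k + j * (n %/ p))| <= (u + v)%:R * r.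
    by move=> lt_j; apply: b1; apply: base_shift.
  have /(b2 k dv_k) b : ~~ (n %| k * M)%N.
    by apply: contra ndv_k; rewrite mulnA; apply: dvdn_mulr.
  have b' := twist_free p_gt1 dv_pn bk; rewrite -[twist h' k](subrK (twist h k)).
  apply: le_trans (ler_normD _ _) (le_trans (lerD b' b) _).
  by rewrite le_eqVlt; apply/orP; left; apply/eqP; ring.
have bk j : (0 < j < p)%N -> `|twist h (0 + j * (n %/ p))| <= (u + v)%:R * r.
  by move=> lt_j; apply: b1; apply: base_shift.
have b' := twist_free p_gt1 dv_pn bk.
have -> : twist h' 0 - q%:R = (twist h' 0 - twist h 0) + (twist h 0 - q%:R) by ring.
apply: le_trans (ler_normD _ _) (le_trans (lerD b' b3) _).
by rewrite le_eqVlt; apply/orP; left; apply/eqP; ring.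
Qed.

End Step.

Section Start.

Local Notation T := (twist (fun=> 1)).
Hypothesis cardX : #|X| = q.
Hypothesis T_class :
  forall k, (q.-1 %| k)%N -> ~~ (n %| k)%N -> `|T k| <= 1.
Hypothesis T_generic : forall k, ~~ (q.-1 %| k)%N -> `|T k| <= r.

(** The value 4 makes the coefficient of the trivial character equal to 1. *)
Definition quartic_weight (x : X) : algC := if (l x %% 4 == 2)%N then 4 else 0.

Let dvd4n : (4 %| n)%N.
Proof.
have -> : q = q./2.*2.+1 by rewrite -[LHS]odd_double_half odd_q.
by rewrite /= -!doubleS -!muln2 mulnACA dvdn_mull.
Qed.

(** For z of order 4, the sum 1 - z^i + z^(2i) - z^(3i) is 4 if i = 2 mod 4 and 0 otherwise. *)
Lemma twist_quartic (k : nat) : twist quartic_weight k =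
  T k - T (k + n %/ 4) + T (k + 2 * (n %/ 4)) - T (k + 3 * (n %/ 4)).
Proof.
have prim_z := dvdn_prim_root prim_w dvd4n; set z := w ^+ _ in prim_z.
have z2 : z ^+ 2 = -1.
  have /eqP := prim_expr_order prim_z.
  rewrite (exprM z 2 2) sqrf_eq1 -(prim_order_dvd prim_z) /=.
  by move/eqP.
rewrite /twist -sumrB -big_split -sumrB; apply: eq_bigr => x _ /=.
rewrite !mul1r !(mulnDl k) !(exprD _ (k * l x)).
have zE j : w ^+ (j * (n %/ 4) * l x) = (z ^+ j) ^+ (l x %% 4).
  rewrite -exprM mulnAC mulnC exprM -/z; apply/eqP.
  by rewrite (eq_prim_root_expr prim_z) modnMmr.
have := zE 1%N; rewrite mul1n expr1 => ->; rewrite !{}zE (exprS z 2) z2 mulrN1.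
rewrite /quartic_weight; have := ltn_pmod (l x) (isT : 0 < 4)%N.
case: (l x %% 4)%N => [|[|[|[|//]]]] _ /=; rewrite ?sqrrN ?z2; ring.
Qed.

(** If q = 3 mod 4, all four characters are trivial on F^*, as 4 divides q + 1. If q = 1 mod 4, only
    the trivial and the quadratic one are. *)
Lemma quartic_bounded : char_bounded 4 (if (q %% 4 == 3)%N then 4 else 2)
  (if (q %% 4 == 3)%N then 0 else 2) quartic_weight.
Proof.
have b4 (a b c d A B C D : algC) : `|a| <= A -> `|b| <= B -> `|c| <= C -> `|d| <= D ->
    `|a - b + c - d| <= A + B + C + D.
  move=> bA bB bC bD; apply: le_trans (ler_normB _ _) (lerD _ bD).
  apply: le_trans (ler_normD _ _) (lerD _ bC).
  exact: le_trans (ler_normB _ _) (lerD bA bB).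
have shift4 d k j : (d %| n)%N -> ~~ (d %| k * 4)%N -> ~~ (d %| k + j * (n %/ 4))%N.
  move=> dv_d; apply: contra => /(dvdn_mulr 4).
  by rewrite mulnDl -mulnA divnK // dvdn_addl // dvdn_mull.
have shift4' d k : (d %| n)%N -> ~~ (d %| k * 4)%N -> ~~ (d %| k + n %/ 4)%N.
  by move=> dv_d /(shift4 d k 1%N dv_d); rewrite mul1n.
have ndvdM d k : ~~ (d %| k * 4)%N -> ~~ (d %| k)%N.
  by apply: contra; apply: dvdn_mulr.
have dv_qn : (q.-1 %| n)%N by apply: dvdn_mulr.
have T0 : T 0 = q%:R.
  rewrite /twist -cardX -sum1_card natr_sum.
  by apply: eq_bigr => x _; rewrite mul0n mul1r.
have n_gt0 : (0 < n)%N := prim_order_gt0 prim_w.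
have T_gen k : ~~ (q.-1 %| k * 4)%N -> `|twist quartic_weight k| <= 4 * r.
  move=> ndv_k; rewrite twist_quartic (_ : 4 * r = r + r + r + r); last by ring.
  apply: b4; apply: T_generic.
  - exact: ndvdM.
  - exact: shift4'.
  - exact: shift4.
  - exact: shift4.
have ndv0 j : (0 < j < 4)%N -> ~~ (n %| 0 + j * (n %/ 4))%N.
  move=> /andP[j_gt0 j_lt]; have N_gt0 : (0 < n %/ 4)%N by rewrite divn_gt0 // dvdn_leq.
  rewrite add0n -[X in (X %| _)%N](divnK dvd4n) [(j * _)%N]mulnC dvdn_pmul2l //.
  by rewrite gtnNdvd.
have T0_tri : twist quartic_weight 0 - q%:R =
    0 - T (0 + 1 * (n %/ 4)) + T (0 + 2 * (n %/ 4)) - T (0 + 3 * (n %/ 4)).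
  by rewrite twist_quartic T0 mul1n; ring.
have q_mod : q = (4 * (q %/ 4) + q %% 4)%N by rewrite [LHS](divn_eq q 4) mulnC.
have [q4|q4] := eqVneq (q %% 4)%N 3%N.
  have dv_N j : (q.-1 %| j * (n %/ 4))%N.
    apply: dvdn_mull; rewrite -muln_divA; first exact: dvdn_mulr.
    by rewrite q_mod q4 -addnS dvdn_add ?dvdn_mulr.
  split=> [k /T_gen //|k dv_k ndv_k|].
    rewrite twist_quartic (_ : 4 + _ = 1 + 1 + 1 + 1); last by ring.
    have dv_N1 : (q.-1 %| n %/ 4)%N by have := dv_N 1%N; rewrite mul1n.
    apply: b4; apply: T_class => //; try exact: dvdn_add.
    - exact: ndvdM.
    - exact: shift4'.
    - exact: shift4.
    - exact: shift4.
  rewrite T0_tri (_ : 4 - 1 + _ = 0 + 1 + 1 + 1); last by ring.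
  by apply: b4; rewrite ?normr0 //; apply: T_class; rewrite ?ndv0 // add0n.
have {}q4 : (q = 4 * (q %/ 4) + 1)%N.
  by move: q_mod q4 odd_q; lia.
have nE : (n %/ 4 = (q %/ 4) * q.+1)%N.
  by rewrite {1}q4 addn1 /= -mulnA mulKn.
have a_gt0 : (0 < q %/ 4)%N by move: q4 q_gt1; lia.
have q1E : (q.-1 = q %/ 4 * 4)%N by move: q4; lia.
have dv_2 : (q.-1 %| 2 * (n %/ 4))%N.
  rewrite nE mulnCA q1E dvdn_pmul2l //.
  by move: q4; lia.
have ndv_odd k j : (q.-1 %| k)%N -> odd j -> ~~ (q.-1 %| k + j * (n %/ 4))%N.
  move=> dv_k odd_j; rewrite dvdn_addr // nE mulnCA q1E dvdn_pmul2l //.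
  have -> : (j * q.+1 = j * (q %/ 4) * 4 + j * 2)%N by rewrite {1}q4; lia.
  by move: odd_j; lia.
have ndv_1 k : (q.-1 %| k)%N -> ~~ (q.-1 %| k + n %/ 4)%N.
  by move=> dv_k; rewrite -[(n %/ 4)%N]mul1n ndv_odd.
split=> [k /T_gen //|k dv_k ndv_k|].
  rewrite twist_quartic (_ : 2 + _ = 1 + r + 1 + r); last by ring.
  apply: b4.
  - by apply: T_class => //; apply: ndvdM.
  - by apply: T_generic; apply: ndv_1.
  - by apply: T_class; [rewrite dvdn_add | apply: shift4].
  - by apply: T_generic; apply: ndv_odd.
rewrite T0_tri (_ : 2 - 1 + _ = 0 + r + 1 + r); last by ring.
apply: b4; rewrite ?normr0 //.
- by apply: T_generic; apply: ndv_odd.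
- by apply: T_class; [rewrite add0n | apply: ndv0].
- by apply: T_generic; apply: ndv_odd.
Qed.

End Start.

(** * Union bound over the remaining primes *)

Section Sift.

Variables (h : X -> algC) (M u v : nat) (s : seq nat).
Hypotheses (bh : char_bounded M u v h) (h_ge0 : forall x, 0 <= h x).
Hypothesis s_ok : forall p, p \in s ->
  [/\ (1 < p)%N, odd p, coprime p M & (p %| q.-1)%N || (p %| q.+1)%N].
Local Notation delta := (1 - \sum_(p <- s) p%:R^-1 : algC).
Local Notation cost p :=
  (if (p %| q.+1)%N then u%:R + v%:R * r else (u + v)%:R * r).
Hypothesis delta_ge0 : 0 <= delta.

(** The indicator of p | i equals 1/p + (1 - 1/p) (1 - [free_weight p i]), and [twist_free] bounds
    the contribution of the second term. *)
Lemma sift_multiples (p : nat) : p \in s ->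
  \sum_x h x * (p %| l x)%:R <= twist h 0 / p%:R + (1 - p%:R^-1) * cost p.
Proof.
move=> /s_ok[p_gt1 odd_p copM dv_p].
have T0E f : twist f 0 = \sum_x f x by apply: eq_bigr => x _; rewrite mul0n mulr1.
have dv_pn : (p %| n)%N by case/orP: dv_p; [apply: dvdn_mulr | apply: dvdn_mull].
have [b1 b2 _] := bh.
have bj j : (0 < j < p)%N -> `|twist h (0 + j * (n %/ p))| <= cost p.
  move=> lt_j; case: ifP => dv_p1.
    apply: b2; last by rewrite add0n class_shift.
    by rewrite add0n; apply: dvdn_mull; rewrite -muln_divA //; apply: dvdn_mulr.
  by apply: b1; apply: base_shift => //; move: dv_p; rewrite dv_p1 orbF.
have := twist_free p_gt1 dv_pn bj; set h' := fun x => _.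
have nz_p : p%:R != 0 :> algC by rewrite pnatr_eq0 -lt0n ltnW.
have nz_p1 : p%:R - 1 != 0 :> algC by rewrite subr_eq0 (eqr_nat _ p 1) neq_ltn p_gt1 orbT.
have -> : \sum_x h x * (p %| l x)%:R =
    twist h 0 / p%:R + (1 - p%:R^-1) * (twist h 0 - twist h' 0).
  rewrite !T0E mulr_suml -sumrB mulr_sumr -big_split; apply: eq_bigr => x _ /=.
  by rewrite /h' /free_weight; case: ifP => _ /=; field; rewrite ?nz_p ?nz_p1.
move=> b; rewrite lerD2l ler_wpM2l //.
  by rewrite subr_ge0 invf_le1 ?ler1n ?ltr0n ltnW.
apply: le_trans b; rewrite distrC; apply: real_ler_norm.
rewrite rpredB // ger0_real // T0E sumr_ge0 // => x _.
by rewrite mulr_ge0 // free_weight_ge0 // ltnW.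
Qed.

Lemma sift_inequality : (forall x, h x != 0 -> has (fun p => p %| l x)%N s) ->
  delta * (q%:R - (u%:R - 1 + v%:R * r)) <=
    \sum_(p <- s) (1 - p%:R^-1) * cost p.
Proof.
move=> bad; have T0E : twist h 0 = \sum_x h x.
  by apply: eq_bigr => x _; rewrite mul0n mulr1.
have T0_real : twist h 0 \is Num.real by rewrite ger0_real // T0E sumr_ge0.
have T0_ge : q%:R - (u%:R - 1 + v%:R * r) <= twist h 0.
  have [_ _] := bh; rewrite real_ler_distl; last by rewrite rpredB ?realn.
  by case/andP.
apply: le_trans (ler_wpM2l delta_ge0 T0_ge) _.
rewrite mulrBl mul1r lerBlDr mulr_suml -big_split /=.
have : \sum_x h x <= \sum_(p <- s) \sum_x h x * (p %| l x)%:R.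
  rewrite exchange_big; apply: ler_sum => x _; rewrite -mulr_sumr.
  have [->|/bad/hasP[p ps dv_p]] := eqVneq (h x) 0; first by rewrite mul0r.
  by rewrite -{1}[h x]mulr1 ler_wpM2l // (big_rem p) //= dv_p lerDl sumr_ge0.
rewrite -T0E => le_T0; apply: le_trans le_T0 _.
rewrite big_seq [leRHS]big_seq; apply: ler_sum => p ps.
by apply: le_trans (sift_multiples ps) _; rewrite addrC [_^-1 * _]mulrC.
Qed.

End Sift.

End CharacterSieve.

(** * The explicit sieve criterion *)

Definition odd_primes (q : nat) : seq nat := [seq p <- primes (q.-1 * q.+1) | odd p].

(* The pair (u, v) of [char_bounded] for the weight with core primes c. *)
Fixpoint char_weights (q : nat) (c : seq nat) : nat * nat :=
  if c is p :: c' then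
    let uv := char_weights q c' in
    if (p %| q.+1)%N then (2 * uv.1, 2 * uv.2)%N else (uv.1, 2 * uv.2 + uv.1)%N
  else if (q %% 4 == 3)%N then (4, 0)%N else (2, 2)%N.

Definition sift_cost (q : nat) (uv : nat * nat) (p : nat) : algC :=
  if (p %| q.+1)%N then uv.1%:R + uv.2%:R * sqrtC q%:R
  else (uv.1 + uv.2)%:R * sqrtC q%:R.

Definition sifting_density (s : seq nat) : algC := 1 - \sum_(p <- s) p%:R^-1.

(** Here c holds the core primes and s the sifted ones; the last clause contradicts the conclusion
    of [sift_inequality]. *)
Definition sieve_succeeds (q : nat) (c s : seq nat) : Prop :=
  let uv := char_weights q c in
  [/\ perm_eq (c ++ s) (odd_primes q), 0 <= sifting_density s
    & \sum_(p <- s) (1 - p%:R^-1) * sift_cost q uv p <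
      sifting_density s * (q%:R - (uv.1%:R - 1 + uv.2%:R * sqrtC q%:R))].

Lemma mem_odd_primes (q p : nat) : (1 < q)%N -> p \in odd_primes q ->
  [/\ prime p, odd p & (p %| q.-1)%N || (p %| q.+1)%N].
Proof.
move=> q_gt1; rewrite mem_filter mem_primes => /and4P[-> pr_p _].
by rewrite Euclid_dvdM.
Qed.

Lemma coprime_core (q p : nat) (c : seq nat) : (1 < q)%N ->
  p \in odd_primes q -> {subset c <= odd_primes q} -> p \notin c ->
  coprime p (4 * \prod_(p' <- c) p').
Proof.
move=> q_gt1 odd_p sub_c pNc; have [pr_p p_odd _] := mem_odd_primes q_gt1 odd_p.
rewrite coprimeMr (@coprimeXr 2 p 2) ?coprimen2 //= big_seq.
elim/big_rec: _ => [|p' m c_p' cop_m]; first exact: coprimen1.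
rewrite coprimeMr cop_m andbT prime_coprime // dvdn_prime2 //.
  by apply: contraNneq pNc => ->.
by have [] := mem_odd_primes q_gt1 (sub_c p' c_p').
Qed.

Section SieveOnLogarithms.

Variables (X : finType) (l : X -> nat) (q : nat) (w : algC).
Local Notation n := (q.-1 * q.+1)%N.
Local Notation r := (sqrtC q%:R).
Local Notation T := (twist l w (fun=> 1)).
Hypotheses (q_gt1 : (1 < q)%N) (odd_q : odd q) (prim_w : n.-primitive_root w).
Hypothesis cardX : #|X| = q.
Hypothesis T_class :
  forall k, (q.-1 %| k)%N -> ~~ (n %| k)%N -> `|T k| <= 1.
Hypothesis T_generic : forall k, ~~ (q.-1 %| k)%N -> `|T k| <= r.

Lemma core_weight (c : seq nat) : uniq c -> {subset c <= odd_primes q} ->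
  exists h : X -> algC,
    [/\ char_bounded l q w r (4 * \prod_(p <- c) p)
          (char_weights q c).1 (char_weights q c).2 h,
        forall x, 0 <= h x
      & forall x, h x != 0 -> (l x %% 4 = 2)%N /\ all (fun p => ~~ (p %| l x))%N c].
Proof.
elim: c => [_ _|p c IHc /= /andP[pNc uniq_c] sub_c].
  exists (quartic_weight l); split=> [|x|x].
  - rewrite big_nil muln1 /=.
    have := quartic_bounded q_gt1 odd_q prim_w cardX T_class T_generic.
    by case: ifP.
  - by rewrite /quartic_weight; case: ifP.
  by rewrite /quartic_weight; case: (eqVneq (l x %% 4)%N 2%N) => [-> | _]; rewrite ?eqxx.
have [|h [bh h_ge0 hP]] := IHc uniq_c.
  by move=> p' c_p'; apply: sub_c; rewrite inE c_p' orbT.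
have [pr_p odd_p dv_p] := mem_odd_primes q_gt1 (sub_c p (mem_head _ _)).
have p_gt1 := prime_gt1 pr_p.
have cop_p : coprime p (4 * \prod_(p <- c) p).
  apply: (coprime_core q_gt1) => //; first exact: sub_c (mem_head _ _).
  by move=> p' c_p'; apply: sub_c; rewrite inE c_p' orbT.
exists (fun x => h x * free_weight p (l x)); split=> [|x|x].
- rewrite big_cons mulnCA mulnC; case: ifPn dv_p => [dv_p _|ndv_p].
    exact: char_bounded_freeS.
  by rewrite orbF => dv_p; apply: char_bounded_freeP.
- by rewrite mulr_ge0 // free_weight_ge0 // ltnW.
rewrite mulf_eq0 negb_or => /andP[/hP[-> all_c]].
by rewrite /free_weight all_c andbT; case: ifP; rewrite ?eqxx.
Qed.

Lemma sieve_logarithms (c s : seq nat) : sieve_succeeds q c s ->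
  exists x, (l x %% 4 = 2)%N /\ forall p, p \in odd_primes q -> ~~ (p %| l x)%N.
Proof.
case=> perm_cs delta_ge0 lt_cost.
have uniq_cs : uniq (c ++ s) by rewrite (perm_uniq perm_cs) filter_uniq ?primes_uniq.
have sub_cs p : p \in c ++ s -> p \in odd_primes q by rewrite (perm_mem perm_cs).
move: uniq_cs; rewrite cat_uniq => /and3P[uniq_c /hasPn sNc uniq_s].
have [|h [bh h_ge0 hP]] := core_weight uniq_c.
  by move=> p c_p; apply: sub_cs; rewrite mem_cat c_p.
have s_ok p : p \in s -> [/\ (1 < p)%N, odd p, coprime p (4 * \prod_(p <- c) p)
    & (p %| q.-1)%N || (p %| q.+1)%N].
  move=> s_p; have odd_s : p \in odd_primes q by rewrite sub_cs // mem_cat s_p orbT.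
  have [pr_p odd_p dv_p] := mem_odd_primes q_gt1 odd_s.
  split=> //; first exact: prime_gt1.
  apply: (coprime_core q_gt1) => //; last exact: sNc.
  by move=> p' c_p'; rewrite sub_cs // mem_cat c_p'.
have [/existsP[x /andP[nz_h s_x]]|] :=
    boolP [exists x, (h x != 0) && ~~ has (fun p => p %| l x)%N s].
  have [l4 all_c] := hP x nz_h; exists x; split=> // p.
  rewrite -(perm_mem perm_cs) mem_cat => /orP[|s_p]; first exact: (allP all_c).
  exact: (hasPn s_x).
rewrite negb_exists => /forallP none.
have bad x : h x != 0 -> has (fun p => p %| l x)%N s.
  by move=> nz_h; have := none x; rewrite nz_h negbK.
have := sift_inequality q_gt1 prim_w bh h_ge0 s_ok delta_ge0 bad.
by rewrite (lt_geF lt_cost).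
Qed.

End SieveOnLogarithms.

Lemma prim_root_half (K : fieldType) (g : K) (n i : nat) :
  n.-primitive_root g -> (4 %| n)%N -> (i %% 4 = 2)%N ->
  (forall p, prime p -> odd p -> (p %| n)%N -> ~~ (p %| i)%N) ->
  (n %/ 2).-primitive_root (g ^+ i).
Proof.
move=> prim_g dv4 i4 iP; suff <- : gcdn i n = 2%N by apply: exp_prim_root.
have dv2 : (2 %| gcdn i n)%N.
  by rewrite dvdn_gcd (dvdn_trans _ dv4) // /dvdn -(modn_dvdm i (isT : 2 %| 4)%N) i4.
have [m gE] := dvdnP dv2.
have m_dv : (m * 2 %| i)%N && (m * 2 %| n)%N by rewrite -dvdn_gcd -gE.
have [m1|m_gt1|m0] := ltngtP m 1%N; last by rewrite gE m0.
  move: m1 gE i4; rewrite ltnS leqn0 => /eqP-> /eqP.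
  by rewrite mul0n eqn0Ngt gcdn_gt0; case: i {iP m_dv dv2}.
have pr_p := pdiv_prime m_gt1; have dv_p := pdiv_dvd m.
case/andP: m_dv => dv_i dv_n.
have [odd_p|/negbTE even_p] := boolP (odd (pdiv m)).
  have := iP _ pr_p odd_p; rewrite (dvdn_trans _ dv_n) ?dvdn_mulr //.
  by rewrite (dvdn_trans _ dv_i) ?dvdn_mulr // => /(_ isT).
have p2 : pdiv m = 2%N by apply/esym/eqP; case: (even_prime pr_p) even_p => // ->.
have : (4 %| i)%N by rewrite (dvdn_trans _ dv_i) // (@dvdn_pmul2r 2 2) // -p2.
by rewrite /dvdn i4.
Qed.

Lemma line_two_primitive (F K : finFieldType) (iota : {rmorphism F -> K})
    (alpha theta : K) (c s : seq nat) :
  #|K| = (#|F| ^ 2)%N -> odd #|F| -> alpha != 0 -> (forall x, theta != iota x) ->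
  sieve_succeeds #|F| c s ->
  exists x, ((#|F| ^ 2 - 1) %/ 2).-primitive_root (alpha * (theta + iota x)).
Proof.
move=> cardK odd_q nz_alpha thetaNF ok.
have q_gt1 := finNzRing_gt1 F; set q := #|F| in cardK odd_q ok q_gt1 *.
have nE : #|K|.-1 = (q.-1 * q.+1)%N.
  by have := subn_sqr q 1; rewrite exp1n !subn1 -cardK addn1.
have [g prim_g] := finField_prim_root K.
have n_gt0 := prim_order_gt0 prim_g.
have [w prim_w] := C_prim_root_exists n_gt0.
pose l x := dlog g (alpha * (theta + iota x)).
have nz_x x : alpha * (theta + iota x) != 0.
  by rewrite mulf_neq0 // theta_add_neq0.
have TE k : twist l w (fun=> 1) k = \sum_x mchar g w k (alpha * (theta + iota x)).
  by apply: eq_bigr => x _; rewrite mul1r mcharE.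
have [||k dv_k ndv_k|k ndv_k|x [l4 lP]] :=
  @sieve_logarithms F l q w q_gt1 odd_q _ _ _ _ c s ok.
- by rewrite -nE.
- by [].
- rewrite TE (line_sum_class cardK prim_g prim_w) ?nE //.
  by rewrite normrN (norm_mchar _ prim_w).
- rewrite TE -(@ler_pXn2r _ 2) ?nnegrE ?sqrtC_ge0 ?ler0n //.
  by rewrite (line_sum_norm cardK prim_g prim_w) // sqrtCK.
exists x; rewrite -(dlogK prim_g (nz_x x)) -cardK subn1.
apply: prim_root_half => // [|p pr_p odd_p dv_p].
  rewrite nE; have -> : q = q./2.*2.+1 by rewrite -[LHS]odd_double_half odd_q.
  by rewrite /= -!doubleS -!muln2 mulnACA dvdn_mull.
by apply: lP; rewrite mem_filter odd_p mem_primes pr_p -nE n_gt0.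
Qed.

(** * Small q *)

(* Trial division from d on, with multiplicity; None when the fuel runs out. *)
Fixpoint prime_factors (fuel : nat) (d m : N) : option (seq N) :=
  if fuel is fuel'.+1 then
    if N.ltb m (N.mul d d) then Some (if N.ltb 1 m then [:: m] else [::])
    else let (a, b) := N.div_eucl m d in
      if N.eqb b 0 then omap (cons d) (prime_factors fuel' d a)
      else prime_factors fuel' (N.succ d) m
  else None.

(* Clearing denominators in the sieve inequality: D = prod p, A = D * sum     *)
(* 1/p, and D * sum (1 - 1/p) over the p dividing q + 1 and over the others.  *)
Record sift_data := SiftData
  { sift_prod : N; sift_inv : N; sift_plus : N; sift_minus : N }.

Fixpoint sift_totals (q : N) (s : seq N) : sift_data :=
  if s is p :: s' then
    let: SiftData D A Bp Bm := sift_totals q s' in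
    let e := N.mul (N.pred p) D in
    if N.eqb (N.modulo (N.succ q) p) 0
    then SiftData (N.mul p D) (N.add (N.mul p A) D) (N.add (N.mul p Bp) e) (N.mul p Bm)
    else SiftData (N.mul p D) (N.add (N.mul p A) D) (N.mul p Bp) (N.add (N.mul p Bm) e)
  else SiftData 1 0 0 0.

Fixpoint char_weightsN (q : N) (c : seq N) : N * N :=
  if c is p :: c' then
    let: (u, v) := char_weightsN q c' in
    if N.eqb (N.modulo (N.succ q) p) 0 then (N.mul 2 u, N.mul 2 v)
    else (u, N.add (N.mul 2 v) u)
  else if N.eqb (N.modulo q 4) 3 then (4%num, 0%num) else (2%num, 2%num).

(** Multiplied by D and with sqrt q collected, the sieve inequality reads t sqrt q < x - y, where d
    / D is the sifting density; it is then squared. The tests A < D and y < x guard the truncated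
    subtractions. *)
Definition sieve_checkN (q : N) (c s : seq N) : bool :=
  let: (u, v) := char_weightsN q c in
  let: SiftData D A Bp Bm := sift_totals q s in
  let d := N.sub D A in
  let x := N.mul d (N.succ q) in
  let y := N.add (N.mul d u) (N.mul Bp u) in
  let z := N.sub x y in
  let t := N.add (N.mul d v) (N.add (N.mul Bm (N.add u v)) (N.mul Bp v)) in
  [&& N.ltb A D, N.ltb y x & N.ltb (N.mul (N.mul t t) q) (N.mul z z)].

(** For q in the computed range trial division stops near 122. Running out of fuel can only make a
    test fail. *)
Definition odd_primesN (q : N) : option (seq N) :=
  if (prime_factors 150 2 (N.pred q), prime_factors 150 2 (N.succ q))
    is (Some s1, Some s2)
  then Some [seq p <- undup s1 ++ undup s2 | N.odd p] else None.

Definition sieve_passesN (q : N) : bool :=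
  if odd_primesN q is Some s then
    sieve_checkN q [::] s || has (fun p => sieve_checkN q [:: p] (rem p s)) s
  else false.

Definition exceptional_qN : seq N := map N.of_nat exceptional_q.

Definition not_prime_powerN (q : N) : bool :=
  if prime_factors 150 2 q is Some s then ~~ constant s else false.

Definition small_okN (exc : seq N) (q : N) : bool :=
  [|| sieve_passesN q, q \in exc | not_prime_powerN q].

Fixpoint range_okN (exc : seq N) (k : nat) (q : N) : bool :=
  if k is k'.+1 then small_okN exc q && range_okN exc k' (N.succ (N.succ q)) else true.

(** The invariant is that m has no prime divisor below d: thus a d dividing m is prime, and m < d^2
    leaves m prime or 1. *)
Lemma prime_factorsP (fuel : nat) (d m : N) (s : seq N) :
  prime_factors fuel d m = Some s -> (1 < N.to_nat d)%N -> (0 < N.to_nat m)%N ->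
  (forall p, prime p -> p %| N.to_nat m -> N.to_nat d <= p)%N ->
  forall p, (p \in map N.to_nat s) = prime p && (p %| N.to_nat m)%N.
Proof.
elim: fuel d m s => [//|fuel IHfuel] d m s /=.
case: N.ltb_spec => [lt_m [<-]|_].
  move=> d_gt1 m_gt0 dP p; case: N.ltb_spec => [m_gt1|m_le1] /=.
    have m_gt1' : (1 < N.to_nat m)%N by lia.
    have pr_m : prime (N.to_nat m).
      apply: ltn_pdiv2_prime => //; have := dP _ (pdiv_prime m_gt1') (pdiv_dvd _).
      rewrite -(leq_exp2r _ _ (isT : 0 < 2)%N); apply: leq_trans.
      by rewrite -mulnn; lia.
    rewrite inE; have [->|neq_p] := eqVneq p; first by rewrite pr_m dvdnn.
    have [pr_p|//] := boolP (prime p).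
    by rewrite dvdn_prime2 // (negPf neq_p).
  have -> : N.to_nat m = 1%N by lia.
  by rewrite /= dvdn1; have [->|_] := eqVneq p 1%N; rewrite ?andbF.
have := N.div_eucl_spec m d; have := N.mod_lt m d; rewrite /N.modulo.
case: N.div_eucl => a b /= lt_b mE.
case: N.eqb_spec => [b0|nz_b].
  case Es: prime_factors => [s'|] //= [<-] d_gt1 m_gt0 dP p.
  have mE' : N.to_nat m = (N.to_nat d * N.to_nat a)%N by lia.
  have pr_d : prime (N.to_nat d).
    have p_le := dP _ (pdiv_prime d_gt1); rewrite mE' dvdn_mulr ?pdiv_dvd // in p_le.
    have /eqP <- : pdiv (N.to_nat d) == N.to_nat d; last exact: pdiv_prime.
    by rewrite eqn_leq p_le // pdiv_leq // ltnW.
  have a_gt0 : (0 < N.to_nat a)%N by move: m_gt0; rewrite mE' muln_gt0 => /andP[].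
  rewrite inE (IHfuel _ _ _ Es) // => [|p' pr_p' dv_p']; last first.
    by apply: dP; rewrite // mE' dvdn_mull.
  have [pr_p|Npr_p] := boolP (prime p); last first.
    by rewrite orbF; apply: contraNF Npr_p => /eqP->.
  by rewrite mE' Euclid_dvdM //= (dvdn_prime2 pr_p pr_d).
move=> Es d_gt1 m_gt0 dP; apply: (IHfuel _ _ _ Es) => // [|p pr_p dv_p].
  by lia.
have p_ge := dP p pr_p dv_p; rewrite N2Nat.inj_succ ltn_neqAle p_ge andbT.
apply: contraTneq dv_p => <-.
have -> : N.to_nat m = (N.to_nat a * N.to_nat d + N.to_nat b)%N by lia.
by rewrite dvdn_addr ?dvdn_mull // gtnNdvd; lia.
Qed.


Lemma N2Nat_modn (a p : N) : (0 < N.to_nat p)%N ->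
  N.to_nat (N.modulo a p) = (N.to_nat a %% N.to_nat p)%N.
Proof.
move=> p_gt0; have aE := N.div_mod' a p; have lt_ap := N.mod_lt a p.
have -> : N.to_nat a = (N.to_nat (N.div a p) * N.to_nat p + N.to_nat (N.modulo a p))%N.
  by rewrite {1}aE; lia.
by rewrite modnMDl modn_small //; lia.
Qed.

Lemma eqb_to_nat (a b : N) : N.eqb a b = (N.to_nat a == N.to_nat b).
Proof. by apply/idP/idP; lia. Qed.

Lemma eqb_modN (a p : N) : (0 < N.to_nat p)%N ->
  N.eqb (N.modulo a p) 0 = (N.to_nat p %| N.to_nat a)%N.
Proof. by move=> p_gt0; rewrite eqb_to_nat N2Nat_modn. Qed.

Lemma char_weightsNE (q : N) (c : seq N) : all (fun p => 0 < N.to_nat p)%N c ->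
  char_weights (N.to_nat q) (map N.to_nat c) =
    (N.to_nat (char_weightsN q c).1, N.to_nat (char_weightsN q c).2).
Proof.
elim: c => [_|p c IHc /= /andP[p_gt0 /IHc->]] /=.
  by rewrite eqb_to_nat N2Nat_modn //; case: ifP.
case: char_weightsN => u v; rewrite eqb_modN // N2Nat.inj_succ.
have E2 x : (2 * N.to_nat x)%N = N.to_nat (N.mul 2 x) by lia.
by case: ifP => _; congr pair; rewrite ?N2Nat.inj_add -?E2.
Qed.

Local Notation natC := (fun x : N => (N.to_nat x)%:R : algC).

Lemma sift_totalsP (q : N) (s : seq N) (uv : nat * nat) :
  all (fun p => 0 < N.to_nat p)%N s ->
  let: SiftData D A Bp Bm := sift_totals q s in
  let s' := map N.to_nat s in let r := sqrtC (natC q) in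
  [/\ (0 < N.to_nat D)%N, natC A = natC D * \sum_(p <- s') p%:R^-1
    & natC Bp * (uv.1%:R + uv.2%:R * r) + natC Bm * ((uv.1 + uv.2)%:R * r) =
      natC D * \sum_(p <- s') (1 - p%:R^-1) * sift_cost (N.to_nat q) uv p].
Proof.
elim: s => [_|p s IHs /= /andP[p_gt0 /IHs]] /=.
  by split; rewrite // !big_nil !mulr0 ?mul0r ?addr0.
case: sift_totals => D A Bp Bm [D_gt0 AE BE].
have nz_p : (N.to_nat p)%:R != 0 :> algC by rewrite pnatr_eq0 -lt0n.
have pE : natC (N.pred p) = natC p - 1 :> algC.
  by rewrite (_ : N.to_nat (N.pred p) = N.to_nat p - 1)%N ?natrB //; lia.
have AE' : natC (N.add (N.mul p A) D) =
    natC (N.mul p D) * \sum_(p <- map N.to_nat (p :: s)) p%:R^-1.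
  rewrite N2Nat.inj_add !N2Nat.inj_mul natrD !natrM AE big_cons.
  by field.
have D'_gt0 : (0 < N.to_nat (N.mul p D))%N.
  by rewrite N2Nat.inj_mul muln_gt0 p_gt0.
rewrite eqb_modN // N2Nat.inj_succ; case: ifP => dv_p; split=> //.
all: rewrite big_cons {1}/sift_cost dv_p.
all: rewrite !(N2Nat.inj_add, N2Nat.inj_mul) !(natrD, natrM) pE [RHS]mulrDr.
all: by rewrite -[X in _ = _ + X]mulrA -BE; field.
Qed.

Lemma sieve_checkN_succeeds (q : N) (c s : seq N) :
  all (fun p => 0 < N.to_nat p)%N c -> all (fun p => 0 < N.to_nat p)%N s ->
  perm_eq (map N.to_nat (c ++ s)) (odd_primes (N.to_nat q)) ->
  sieve_checkN q c s -> sieve_succeeds (N.to_nat q) (map N.to_nat c) (map N.to_nat s).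
Proof.
move=> c_gt0 s_gt0 perm_cs; rewrite /sieve_checkN /sieve_succeeds char_weightsNE //.
case: char_weightsN => u v; rewrite -map_cat /=.
have := sift_totalsP q (N.to_nat u, N.to_nat v) s_gt0.
case: sift_totals => D A Bp Bm /= [D_gt0 AE BE].
set d := N.sub D A; set x := N.mul d (N.succ q); set y := N.add (N.mul d u) _.
set z := N.sub x y; set t := N.add (N.mul d v) _.
case/and3P=> lt_AD lt_yx lt_tz; set r := sqrtC _ in BE *.
have D_gt0' : 0 < natC D :> algC by rewrite ltr0n.
have ltN a b : N.ltb a b -> natC a < natC b :> algC by rewrite ltr_nat; lia.
have dE : natC d = natC D * sifting_density (map N.to_nat s).
  rewrite mulrBr mulr1 -AE /d.
  rewrite (_ : N.to_nat (N.sub D A) = N.to_nat D - N.to_nat A)%N; last by lia.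
  by rewrite natrB //; lia.
have d_gt0 : 0 < natC d :> algC by rewrite ltr0n /d; lia.
split=> //; first by rewrite -(pmulr_rge0 _ D_gt0') -dE ltW.
rewrite -(ltr_pM2l D_gt0') mulrA -dE -BE.
have r_ge0 : 0 <= r by rewrite sqrtC_ge0 ler0n.
have lt_tr : natC t * r < natC z.
  rewrite -(@ltr_pXn2r _ 2) ?nnegrE ?mulr_ge0 ?ler0n // exprMn sqrtCK.
  have := ltN _ _ lt_tz; rewrite !N2Nat.inj_mul !natrM; apply: le_lt_trans.
  by rewrite expr2.
have zE : natC z = natC x - natC y :> algC.
  rewrite /z (_ : N.to_nat (N.sub x y) = N.to_nat x - N.to_nat y)%N; last by lia.
  by rewrite natrB //; lia.
move: lt_tr; rewrite zE ltrBrDr /t /x /y.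
rewrite !(N2Nat.inj_add, N2Nat.inj_mul, N2Nat.inj_succ) -addn1 !(natrD, natrM).
rewrite -[in X in X -> _]subr_gt0 => lt_tr; rewrite -subr_gt0.
by apply: etrans lt_tr; congr (0 < _); ring.
Qed.

(** A common prime of q - 1 and q + 1 divides 2, so the two lists share no odd entry. *)
Lemma odd_primesNP (q : N) (s : seq N) : (1 < N.to_nat q)%N ->
  odd_primesN q = Some s -> perm_eq (map N.to_nat s) (odd_primes (N.to_nat q)).
Proof.
move=> q_gt1; rewrite /odd_primesN.
case E1: prime_factors => [s1|//]; case E2: prime_factors => [s2|//] [<-].
have mem1 := prime_factorsP E1 isT _ (fun p pr _ => prime_gt1 pr).
have mem2 := prime_factorsP E2 isT _ (fun p pr _ => prime_gt1 pr).
have q1E : N.to_nat (N.pred q) = (N.to_nat q).-1 by lia.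
have q2E : N.to_nat (N.succ q) = (N.to_nat q).+1 by lia.
rewrite q1E q2E in mem1 mem2.
have {}mem1 := mem1 (ltac:(lia)); have {}mem2 := mem2 (ltac:(lia)).
have oddE p : N.odd p = odd (N.to_nat p).
  elim/N.peano_ind: p => // p IHp.
  by rewrite N.odd_succ -N.negb_odd IHp N2Nat.inj_succ.
have injN : injective N.to_nat by exact: N2Nat.inj.
apply: uniq_perm.
- rewrite map_inj_uniq // filter_cat cat_uniq !filter_uniq ?undup_uniq //= andbT.
  apply/hasPn=> p; rewrite !mem_filter !mem_undup => /andP[odd_p s2_p].
  rewrite odd_p /=; apply/negP => s1_p.
  have /andP[pr_p dv1] : prime (N.to_nat p) && (N.to_nat p %| (N.to_nat q).-1)%N.
    by rewrite -mem1 map_f.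
  have /andP[_ dv2] : prime (N.to_nat p) && (N.to_nat p %| (N.to_nat q).+1)%N.
    by rewrite -mem2 map_f.
  have : (N.to_nat p %| 2)%N.
    have := dvdn_sub dv2 dv1; congr (_ %| _)%N; lia.
  by rewrite dvdn_prime2 // => /eqP p2; move: odd_p; rewrite oddE p2.
- by rewrite filter_uniq ?primes_uniq.
move=> p; rewrite [RHS]mem_filter mem_primes muln_gt0 -ltnS (ltn_predK q_gt1) q_gt1 /=.
have [odd_p|even_p] /= := boolP (odd p); last first.
  apply: contraNF even_p => /mapP[p']; rewrite mem_filter => /andP[odd_p' _] ->.
  by rewrite -oddE.
have -> : (p \in map N.to_nat [seq p <- undup s1 ++ undup s2 | N.odd p]) =
    (p \in map N.to_nat s1) || (p \in map N.to_nat s2).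
  rewrite -[p]Nat2N.id !mem_map // mem_filter oddE Nat2N.id odd_p /=.
  by rewrite mem_cat !mem_undup.
rewrite mem1 mem2; have [pr_p|//] := boolP (prime p).
by rewrite Euclid_dvdM.
Qed.

Lemma sieve_passesN_succeeds (q : N) : (1 < N.to_nat q)%N -> sieve_passesN q ->
  exists c s, sieve_succeeds (N.to_nat q) c s.
Proof.
move=> q_gt1; rewrite /sieve_passesN; case Es: odd_primesN => [s|//].
have perm_s := odd_primesNP q_gt1 Es.
have s_gt0 : all (fun p => 0 < N.to_nat p)%N s.
  apply/allP=> p s_p; have : N.to_nat p \in odd_primes (N.to_nat q).
    by rewrite -(perm_mem perm_s) map_f.
  by rewrite mem_filter mem_primes => /and3P[_ /prime_gt0].
case/orP=> [ok|/hasP[p s_p ok]].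
  by exists [::], (map N.to_nat s); apply: (sieve_checkN_succeeds (c := [::])).
exists [:: N.to_nat p], (map N.to_nat (rem p s)).
apply: (sieve_checkN_succeeds (c := [:: p])) => //=.
- by rewrite (allP s_gt0).
- by apply/allP=> p' /mem_rem /(allP s_gt0).
apply: perm_trans perm_s; rewrite -map_cons perm_map // perm_sym.
exact: perm_to_rem.
Qed.

Lemma not_prime_powerNP (q : N) : (0 < N.to_nat q)%N -> not_prime_powerN q ->
  ~ odd_prime_power (N.to_nat q).
Proof.
move=> q_gt0; rewrite /not_prime_powerN; case Es: prime_factors => [s|//].
have memP := prime_factorsP Es isT q_gt0 (fun p pr _ => prime_gt1 pr).
move=> Ncst [_ [p [k [pr_p k_gt0 qE]]]]; case/negP: Ncst.
apply: (@all_pred1_constant _ (N.of_nat p)); apply/allP => d s_d /=.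
have : N.to_nat d \in map N.to_nat s by rewrite map_f.
rewrite memP qE => /andP[pr_d]; rewrite Euclid_dvdX // k_gt0 andbT.
by rewrite dvdn_prime2 // => /eqP <-; rewrite N2Nat.id.
Qed.

Lemma range_okNP (exc : seq N) (k : nat) (q0 q : N) : range_okN exc k q0 ->
  odd (N.to_nat q - N.to_nat q0) = false -> (N.to_nat q0 <= N.to_nat q)%N ->
  (N.to_nat q < N.to_nat q0 + 2 * k)%N -> small_okN exc q.
Proof.
elim: k q0 => [|k IHk] q0 /=; first by lia.
case/andP=> ok0 ok1 even_q le_q lt_q.
have [<-//|neq_q] := eqVneq q0 q; apply: (IHk _ ok1); lia.
Qed.

Lemma range_okN_small : range_okN exceptional_qN (122 * 61) 3.
Proof. by vm_compute. Qed.

Lemma small_okNP (q : nat) : small_okN exceptional_qN (N.of_nat q) ->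
  [\/ sieve_passesN (N.of_nat q), q \in exceptional_q | not_prime_powerN (N.of_nat q)].
Proof.
rewrite /small_okN => /or3P[ok|ok|ok].
- by apply: Or31.
- by move: ok; rewrite mem_map; [apply: Or32 | exact: Nat2N.inj].
- by apply: Or33.
Qed.

Lemma small_okN_odd (q : nat) : (2 < q)%N -> odd q -> (q < 122 * 122)%N ->
  small_okN exceptional_qN (N.of_nat q).
Proof.
move=> q_ge3 odd_q lt_q; have idq := Nat2N.id q.
have {}lt_q : (q < N.to_nat 3 + 2 * (122 * 61))%N by lia.
apply: (range_okNP range_okN_small); rewrite idq //.
by rewrite oddB // odd_q.
Qed.

Lemma small_prime_power_sieve (q : nat) : (q < 122 * 122)%N ->
  odd_prime_power q -> q \notin exceptional_q -> exists c s, sieve_succeeds q c s.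
Proof.
move=> lt_q ppq qNexc; have [odd_q [p [k [pr_p k_gt0 qE]]]] := ppq.
have q_gt1 : (1 < q)%N by rewrite qE -(exp1n k) ltn_exp2r ?prime_gt1.
have q_ge3 : (2 < q)%N by rewrite ltn_neqAle q_gt1 andbT; apply: contraTneq odd_q => <-.
have idq := Nat2N.id q.
have [ok|ok|ok] := small_okNP (small_okN_odd q_ge3 odd_q lt_q).
- by rewrite -idq; apply: sieve_passesN_succeeds; rewrite ?idq.
- by rewrite ok in qNexc.
- by case: (@not_prime_powerNP (N.of_nat q)); rewrite ?idq // ltnW.
Qed.

(** * Large q *)

Lemma char_weights_sum (q : nat) (c : seq nat) :
  ((char_weights q c).1 + (char_weights q c).2 = 4 * 2 ^ size c)%N.
Proof.
elim: c => [|p c IHc] /=; first by case: ifP.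
by rewrite expnS mulnCA -IHc; case: ifP => _ /=; lia.
Qed.

Lemma sifting_density_ge (s : seq nat) (A B : nat) :
  all (fun p => 0 < p)%N s -> (\sum_(p <- s) (B %/ p).+1 + A <= B)%N ->
  A%:R <= B%:R * sifting_density s.
Proof.
move=> s_gt0 le_B; rewrite mulrBr mulr1 mulr_sumr lerBrDr.
apply: le_trans (_ : (A + \sum_(p <- s) (B %/ p).+1)%:R <= _); last first.
  by rewrite ler_nat addnC.
rewrite natrD lerD2l natr_sum big_seq [leRHS]big_seq; apply: ler_sum => p s_p.
have p_gt0 := allP s_gt0 p s_p.
by rewrite ler_pdivrMr ?ltr0n // -natrM ler_nat ltnW // ltn_ceil.
Qed.

(* A / B bounds the sifting density from below and R bounds sqrt q from below. *)
Lemma crude_sieve (q : nat) (c s : seq nat) (A B R : nat) :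
  let t := (4 * 2 ^ size c)%N in
  (1 < q)%N -> perm_eq (c ++ s) (odd_primes q) -> (0 < A)%N ->
  (\sum_(p <- s) (B %/ p).+1 + A <= B)%N -> (R ^ 2 <= q)%N -> (2 * t <= R)%N ->
  (B * (t * (size s).-1) <= A * (R - 2 * t))%N -> sieve_succeeds q c s.
Proof.
move=> t q_gt1 perm_cs A_gt0 le_B le_R le_t le_AB.
have s_gt1 p : p \in s -> (1 < p)%N.
  move=> s_p; have : p \in odd_primes q by rewrite -(perm_mem perm_cs) mem_cat s_p orbT.
  by case/(mem_odd_primes q_gt1) => /prime_gt1.
have s_gt0 : all (fun p => 0 < p)%N s by apply/allP=> p /s_gt1/ltnW.
have := sifting_density_ge s_gt0 le_B; set delta := sifting_density s => le_A.
have B_gt0 : 0 < B%:R :> algC.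
  by rewrite ltr0n (leq_trans A_gt0) // (leq_trans _ le_B) // leq_addl.
have delta_gt0 : 0 < delta.
  by rewrite -(pmulr_rgt0 _ B_gt0) (lt_le_trans _ le_A) ?ltr0n.
pose r : algC := sqrtC q%:R.
have r_ge0 : 0 <= r by rewrite sqrtC_ge0 ler0n.
have r2 : r ^+ 2 = q%:R by rewrite sqrtCK.
have R_le_r : R%:R <= r.
  by rewrite -(@ler_pXn2r _ 2) ?nnegrE ?ler0n // r2 -natrX ler_nat.
have r_ge1 : 1 <= r.
  by rewrite -(@ler_pXn2r _ 2) ?nnegrE ?ler01 // r2 expr1n ler1n ltnW.
(* Every cost is at most t r, and the factors 1 - 1/p add up to |s| - 1 + delta. Multiplying [key]
   by r bounds the total by delta (q - t r), and u - 1 < u r makes the inequality strict. *)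
have key : t%:R * ((size s)%:R - 1) <= delta * (r - 2 * t%:R).
  rewrite -(ler_pM2l B_gt0).
  apply: le_trans (_ : (B * (t * (size s).-1))%:R <= _).
    rewrite (natrM _ B) (natrM _ t) ler_wpM2l ?ler0n // ler_wpM2l ?ler0n //.
    by rewrite lerBlDr -(natrD _ _ 1) ler_nat addn1 leqSpred.
  apply: le_trans (_ : (A * (R - 2 * t))%:R <= _); first by rewrite ler_nat.
  rewrite (natrM _ A) mulrA; apply: ler_pM => //.
  by rewrite natrB // (natrM _ 2) lerD2r.
have := char_weights_sum q c; rewrite -/t => tE.
split=> //; first exact: ltW.
set u := (char_weights q c).1 in tE *; set v := (char_weights q c).2 in tE *.
have u_le : u%:R <= u%:R * r by rewrite ler_peMr ?ler0n.
have cost_le p : p \in s -> (1 - p%:R^-1) * sift_cost q (char_weights q c) p <=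
    (1 - p%:R^-1) * (t%:R * r).
  move=> /s_gt1 p_gt1; rewrite ler_wpM2l //.
    by rewrite subr_ge0 invf_le1 ?ler1n ?ltr0n ltnW.
  rewrite /sift_cost -/u -/v tE; case: ifP => // _.
  by rewrite -tE natrD mulrDl lerD2r.
rewrite -/r big_seq; apply: le_lt_trans (ler_sum _ cost_le) _.
rewrite -big_seq -mulr_suml.
have -> : \sum_(p <- s) (1 - p%:R^-1) = (size s)%:R - 1 + delta :> algC.
  have -> : (size s)%:R = \sum_(p <- s) 1 :> algC by rewrite -sum1_size natr_sum.
  by rewrite sumrB /delta /sifting_density; ring.
apply: le_lt_trans (_ : delta * (q%:R - t%:R * r) < _).
  have := ler_wpM2r r_ge0 key; rewrite -subr_ge0 => ge0; rewrite -subr_ge0.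
  by apply: le_trans ge0 _; rewrite -r2 le_eqVlt; apply/orP; left; apply/eqP; ring.
rewrite ltr_pM2l // -tE natrD ltrD2l ltrN2 mulrDl ltrD2r.
by apply: lt_le_trans u_le; rewrite ltrBlDr ltrDl.
Qed.

(* 3, 5, 7, 11, 13, 17, 19, 23, 25, ... is a lower bound for the odd primes.  *)
Definition coprime6 (i : nat) : nat := if i is 0 then 3 else 3 * i + 1 + odd i.

Lemma odd_primes_sorted (q : nat) : sorted ltn (odd_primes q).
Proof. by rewrite sorted_filter ?sorted_primes //; exact: ltn_trans. Qed.

(** The primes increase strictly and those above 3 are prime to 6, so each is at least the next
    term. *)
Lemma nth_odd_primes_ge (q i : nat) : (1 < q)%N -> (i < size (odd_primes q))%N ->
  (coprime6 i <= nth 0 (odd_primes q) i)%N.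
Proof.
move=> q_gt1; elim: i => [|i IHi] lt_i.
  have [pr_p odd_p _] := mem_odd_primes q_gt1 (mem_nth 0%N lt_i).
  by move: (nth _ _ _) pr_p odd_p => p /prime_gt1 p_gt1 odd_p; rewrite /coprime6; lia.
have [pr_p odd_p _] := mem_odd_primes q_gt1 (mem_nth 0%N lt_i).
have lt_nth : (nth 0 (odd_primes q) i < nth 0 (odd_primes q) i.+1)%N.
  apply: (sorted_ltn_nth ltn_trans 0%N (odd_primes_sorted q)); rewrite ?inE //.
  exact: ltnW.
have {IHi} le_i := IHi (ltnW lt_i).
move: (nth 0 _ i.+1) (nth 0 _ i) pr_p odd_p lt_nth le_i => p p' pr_p odd_p lt_p' le_p'.
have p_gt3 : (3 < p)%N.
  apply: leq_ltn_trans lt_p'; apply: leq_trans le_p'.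
  by case: (i) => // j; rewrite /coprime6; lia.
have N3p : ~~ (3 %| p)%N.
  by rewrite dvdn_prime2 // neq_ltn p_gt3.
case: i {lt_i} le_p' => [|i]; rewrite /coprime6 /=; lia.
Qed.

Lemma prod_primes_dvdn (s : seq nat) (m : nat) : uniq s -> all prime s ->
  all (fun p => p %| m)%N s -> (\prod_(p <- s) p %| m)%N.
Proof.
elim: s => [|p s IHs] /=; first by rewrite big_nil dvd1n.
case/andP=> pNs uniq_s /andP[pr_p pr_s] /andP[dv_p dv_s].
rewrite big_cons Gauss_dvd ?dv_p ?IHs // big_seq.
elim/big_rec: _ => [|p' k s_p' cop_k]; first exact: coprimen1.
have pr_p' := allP pr_s p' s_p'.
rewrite coprimeMr cop_k andbT prime_coprime // (dvdn_prime2 pr_p pr_p').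
by apply: contraNneq pNs => ->.
Qed.

Lemma prod_odd_primes_leq (q : nat) : (1 < q)%N -> odd q ->
  (8 * \prod_(p <- odd_primes q) p <= q.-1 * q.+1)%N.
Proof.
move=> q_gt1 odd_q.
have n_gt0 : (0 < q.-1 * q.+1)%N by rewrite muln_gt0 -ltnS (ltn_predK q_gt1) q_gt1.
have odd_prod : odd (\prod_(p <- odd_primes q) p).
  rewrite big_seq; elim/big_rec: _ => // p m /(mem_odd_primes q_gt1)[_ odd_p _] odd_m.
  by rewrite oddM odd_p odd_m.
apply: dvdn_leq => //; rewrite Gauss_dvd; last first.
  by rewrite (@coprimeXl 3 2) // coprime2n.
apply/andP; split.
  have -> : q = q./2.*2.+1 by rewrite -[LHS]odd_double_half odd_q.
  rewrite /= -!doubleS -!muln2 mulnACA (@dvdn_pmul2r 4 2) // dvdn2 oddM.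
  by rewrite /= andbN.
apply: prod_primes_dvdn; first by rewrite filter_uniq ?primes_uniq.
  by apply/allP=> p; rewrite mem_filter mem_primes => /and3P[].
by apply/allP=> p; rewrite mem_filter mem_primes => /and4P[].
Qed.

Lemma prod_coprime6_lt (q : nat) : (1 < q)%N -> odd q ->
  (8 * \prod_(0 <= i < size (odd_primes q)) coprime6 i < q ^ 2)%N.
Proof.
move=> q_gt1 odd_q; have := prod_odd_primes_leq q_gt1 odd_q.
rewrite (big_nth 0%N) => le_q; apply: leq_ltn_trans (_ : _ <= q.-1 * q.+1)%N _.
  apply: leq_trans le_q; rewrite leq_mul2l /= big_nat [X in (_ <= X)%N]big_nat.
  by apply: leq_prod => i /= lt_i; apply: nth_odd_primes_ge.
by move: q_gt1; case: (q) => // m _ /=; lia.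
Qed.

Lemma sum_drop_odd_primes (q j B : nat) : (1 < q)%N ->
  (\sum_(p <- drop j (odd_primes q)) (B %/ p).+1 <=
   \sum_(j <= i < size (odd_primes q)) (B %/ coprime6 i).+1)%N.
Proof.
move=> q_gt1; rewrite (big_nth 0%N) size_drop.
rewrite -[X in (_ <= \sum_(X <= _ < _) _)%N]add0n big_addn.
rewrite big_nat [X in (_ <= X)%N]big_nat; apply: leq_sum => i /= lt_i.
rewrite ltnS nth_drop addnC leq_div2l //; last first.
  by apply: nth_odd_primes_ge => //; lia.
by case: (i + j)%N => // m; rewrite /coprime6; lia.
Qed.

(** The core consists of the j smallest odd primes, whose inverses would reduce the density most. *)
Lemma split_sieve (q n j A B R : nat) : size (odd_primes q) = n ->
  let t := (4 * 2 ^ minn j n)%N in (1 < q)%N -> (0 < A)%N ->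
  (\sum_(j <= i < n) (B %/ coprime6 i).+1 + A <= B)%N -> (R ^ 2 <= q)%N ->
  (2 * t <= R)%N -> (B * (t * (n - j).-1) <= A * (R - 2 * t))%N ->
  exists c s, sieve_succeeds q c s.
Proof.
move=> sz_n t q_gt1 A_gt0 le_B le_R le_t le_AB.
exists (take j (odd_primes q)), (drop j (odd_primes q)).
have sz : size (take j (odd_primes q)) = minn j n.
  by rewrite size_take_min sz_n.
apply: (@crude_sieve _ _ _ A B R); rewrite ?sz ?size_drop ?sz_n ?cat_take_drop //.
by apply: leq_trans le_B; rewrite leq_add2r -sz_n sum_drop_odd_primes.
Qed.

Lemma sqrt_bound (q R : nat) : (1 < q)%N -> odd q ->
  (R ^ 4 <= 8 * \prod_(0 <= i < size (odd_primes q)) coprime6 i)%N -> (R ^ 2 <= q)%N.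
Proof.
move=> q_gt1 odd_q le_R; rewrite -(leq_exp2r _ _ (isT : 0 < 2)%N) -expnM.
exact: leq_trans le_R (ltnW (prod_coprime6_lt q_gt1 odd_q)).
Qed.

(** From n to n + 1 the product gains a factor of at least 8, while the left side gains 4 times at
    most 2. *)
Lemma prod_coprime6_ge (n : nat) : (12 <= n)%N ->
  (32 * (n.+1 ^ 4 * 4 ^ n) <= \prod_(0 <= i < n) coprime6 i)%N.
Proof.
elim: n => // n IHn; rewrite leq_eqVlt => /predU1P[<-|].
  rewrite !(big_nat_recr _ _ _ (leq0n _)) (big_geq (leqnn _)) !expnS !expn0.
  by rewrite /coprime6 /=; lia.
rewrite ltnS => le_n; rewrite big_nat_recr //=.
have := IHn le_n; set P := \prod_(0 <= i < n) _ => le_P.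
have le_c : (8 <= coprime6 n)%N.
  by case: n le_n {IHn P le_P} => // m le_m; rewrite /coprime6; lia.
apply: leq_trans (leq_mul le_P le_c).
have le_4 : (n.+2 ^ 4 <= 2 * n.+1 ^ 4)%N.
  (* Squaring suffices, as 49/25 < 2. *)
  have le_2 : (5 * n.+2 ^ 2 <= 7 * n.+1 ^ 2)%N by rewrite -!mulnn; nia.
  have := leq_mul le_2 le_2; rewrite mulnACA [X in (_ <= X)%N]mulnACA -!expnD /=.
  by lia.
have := leq_mul le_4 (leqnn (4 ^ n)); rewrite (expnS 4 n).
by move: (4 ^ n)%N (n.+1 ^ 4)%N (n.+2 ^ 4)%N => x b a; lia.
Qed.

Lemma large_sieve (q : nat) : (122 * 122 <= q)%N -> odd q ->
  exists c s, sieve_succeeds q c s.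
Proof.
move=> le_q odd_q; have q_gt1 : (1 < q)%N by lia.
have [n sz_n] : {n | size (odd_primes q) = n} by exists (size (odd_primes q)).
have [le_n|lt_n] := leqP 12 n.
  pose j := n./2; pose k := (n - j)%N.
  have nE : n = (odd n + j.*2)%N by rewrite odd_double_half.
  have kE : k = (odd n + j)%N by rewrite /k; lia.
  have minE : minn j n = j by lia.
  (* The density is at least A / B = 1/2, since each of the k tail terms is at most 5. With t = 4 *
     2^j, the choice R = 2 t k turns the final condition into an equality. *)
  apply: (@split_sieve q n j (6 * j + 2) (4 * (3 * j + 1)) (8 * k * 2 ^ j)) => //.
  - by rewrite addn2.
  - have le_5 : (\sum_(j <= i < n) (4 * (3 * j + 1) %/ coprime6 i).+1 <= 5 * k)%N.
      have -> : (5 * k = \sum_(j <= i < n) 5)%N by rewrite sum_nat_const_nat mulnC.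
      rewrite big_nat [X in (_ <= X)%N]big_nat; apply: leq_sum => i /andP[le_i _].
      have le_c : (3 * j + 1 <= coprime6 i)%N.
        by case: i le_i => [|i] le_i; rewrite /coprime6; lia.
      have j_gt0 : (0 < 3 * j + 1)%N by rewrite addn1.
      by rewrite ltnS -[X in (_ <= X)%N](mulnK 4 j_gt0) leq_div2l.
    apply: leq_trans (leq_add le_5 (leqnn _)) _.
    by move: le_n kE nE; case: (odd n); lia.
  - apply: (sqrt_bound q_gt1 odd_q); rewrite sz_n.
    apply: leq_trans (_ : 8 * (32 * (n.+1 ^ 4 * 4 ^ n)) <= _)%N; last first.
      by rewrite leq_mul2l /= prod_coprime6_ge.
    have le_k : ((2 * k) ^ 4 <= n.+1 ^ 4)%N by rewrite leq_exp2r; lia.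
    have le_4 : ((2 ^ j) ^ 4 <= 4 ^ n)%N.
      rewrite -[X in (_ <= X ^ _)%N]/(2 ^ 2)%N -!expnM leq_pexp2l //; lia.
    have := leq_mul le_k le_4; rewrite !expnMn (_ : 8 ^ 4 = 256 * 2 ^ 4)%N //.
    move: (n.+1 ^ 4)%N (4 ^ n)%N ((2 ^ j) ^ 4)%N (k ^ 4)%N (2 ^ 4)%N => a b c d e.
    by lia.
  - by rewrite minE; nia.
  by rewrite minE; nia.
have le_122 : (122 ^ 2 <= q)%N by rewrite -mulnn.
have le_R R : (R ^ 4 <= 8 * \prod_(0 <= i < n) coprime6 i)%N -> (R ^ 2 <= q)%N.
  by rewrite -sz_n; apply: sqrt_bound.
have ok A B R := @split_sieve q n 1 A B R sz_n q_gt1.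
case: n => [|[|[|[|[|[|[|[|[|[|[|[|n]]]]]]]]]]]] in sz_n lt_n le_R ok *; last by [].
(* The worst case sifts by 5, 7, 11, 13, 17, 19 with t = 8 and needs sqrt q >= 16 + 40 * 3209 /
   1211, just below 122; this fixes the cutoff 122^2. *)
1-8: by apply: (ok 1211 3209 122) => //; rewrite ?unlock; vm_compute.
(* From 8 primes on, the bound on sqrt q comes from the product of the primes: 170 for 8 primes, 380
   for 9 to 11. *)
1: apply: (ok 34 109 170); [by []|by rewrite unlock; vm_compute| |by []|by vm_compute].
2-4: apply: (ok 30 149 380); [by []|by rewrite unlock; vm_compute| |by []|by vm_compute].
all: apply: le_R; rewrite !(big_nat_recr _ _ _ (leq0n _)) (big_geq (leqnn _)) !expnS expn0.
all: by rewrite /coprime6 /=; lia.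
Qed.

(** * Conclusion for quadratic extensions *)

Lemma odd_prime_power_sieve (q : nat) :
  odd_prime_power q -> q \notin exceptional_q -> exists c s, sieve_succeeds q c s.
Proof.
move=> ppq qNexc; have [lt_q|le_q] := ltnP q (122 * 122).
  exact: small_prime_power_sieve.
by apply: large_sieve => //; case: ppq.
Qed.

Lemma fieldExt_line_two_primitive (F : finFieldType) (L : fieldExtType F)
    (c s : seq nat) (alpha theta : L) :
  odd #|F| -> \dim {:L} = 2%N -> sieve_succeeds #|F| c s ->
  alpha != 0 -> theta \notin 1%VS ->
  exists x : F, two_primitive (alpha * (theta + x%:A)).
Proof.
move=> odd_q dimL ok nz_alpha thetaN1.
have cardL : #|finvect_type L| = (#|F| ^ 2)%N.
  by rewrite -(card_vspacef (Vector.class (finvect_type L))) card_vspace dimL.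
pose iota : {rmorphism F -> finvect_type L} := in_alg (finvect_type L).
apply: (@line_two_primitive F (finvect_type L) iota alpha theta c s) => // x.
by apply: contraNneq thetaN1 => ->; apply: rpredZ; apply: mem1v.
Qed.

Theorem theorem6 :
  (forall (q : nat) (F : finFieldType) (L : fieldExtType F),
     odd_prime_power q -> q \notin exceptional_q ->
     #|F| = q -> \dim {:L} = 2%N ->
     forall alpha theta : L, alpha != 0 -> theta \notin 1%VS ->
       exists x : F, two_primitive (alpha * (theta + x%:A)))
  /\
  (forall (q : nat) (F : finFieldType) (L : fieldExtType F),
     odd_prime_power q -> (3541 < q)%N ->
     #|F| = q -> \dim {:L} = 2%N ->
     line_property_two_primitive L).
Proof.
have line (q : nat) (F : finFieldType) (L : fieldExtType F) :
     odd_prime_power q -> q \notin exceptional_q ->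
     #|F| = q -> \dim {:L} = 2%N ->
     forall alpha theta : L, alpha != 0 -> theta \notin 1%VS ->
       exists x : F, two_primitive (alpha * (theta + x%:A)).
  move=> ppq qNexc cardF dimL alpha theta nz_alpha thetaN1.
  have [c [s ok]] := odd_prime_power_sieve ppq qNexc.
  by apply: (@fieldExt_line_two_primitive F L c s); rewrite ?cardF //; case: ppq.
split=> // q F L ppq q_big cardF dimL alpha theta nz_alpha gen_theta.
apply: (line q F L) => //.
  apply: contraL q_big => q_exc; rewrite -leqNgt.
  by move: q q_exc {ppq cardF}; apply/allP.
(* If theta lay in F, then F(theta) = F would have dimension 1 instead of 2. *)
apply/negP => /(@Fadjoin_idP _ _ 1%AS) gen1.
have eq1 : 1%VS = {:L}%VS by rewrite -gen_theta -[LHS]gen1.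
by have := dimv1 L; rewrite eq1 dimL.
Qed.
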